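(* Consider a planar four-bar mechanism with $l_1=l_3=l>0$, $l_2=d>0$ and $l\neq d$, with mass parameters $m_j>0$, $r_j\ge0$, $|p_j|=1$, $I_j>0$ ($j=1,2,3$), and put $q_j=m_jr_jp_j\in\mathbb{C}$ and $J_j=I_j+m_jr_j^2$. The mechanism is dynamically balanced in the mode $z_2\neq -1$ if and only if $$q_1=q_3-l\,m_3,\qquad q_2=-\frac{d}{l}\,q_3,$$ $$J_1=J_3-l^2m_3,\qquad J_2=\frac{l^2-d^2}{l}\,q_3-J_3 .$$
   Context: Kinematics. A planar four-bar mechanism has a fixed base of length $d>0$ and three moving links of lengths $l_1,l_2,l_3>0$. In the complex plane, link 1 runs from $0$ to $l_1z_1$, link 2 from $d$ to $d+l_2z_2$, and link 3 (the coupler) from $l_1z_1$ to $l_1z_1+l_3z_3=d+l_2z_2$, where $z_j=e^{i\theta_j}$ are unit complex numbers. Put $G_1=-l_1/l_3$, $G_2=l_2/l_3$, $G_3=d/l_3$, so $z_3=G_1z_1+G_2z_2+G_3$. A configuration is a pair $(z_1,z_2)$ of unit complex numbers with $$G(z_1,z_2)=(G_1z_1+G_2z_2+G_3)(G_1z_1^{-1}+G_2z_2^{-1}+G_3)-1=0.$$ Differentiating $G=0$ in time gives $i(K_1\dot\theta_1+K_2\dot\theta_2)=0$ with $$K_1=G_1G_2(z_1z_2^{-1}-z_1^{-1}z_2)+G_1G_3(z_1-z_1^{-1}),\qquad K_2=G_1G_2(z_1^{-1}z_2-z_1z_2^{-1})+G_2G_3(z_2-z_2^{-1}).$$ Mass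 parameters. Link $j$ has mass $m_j>0$, moment of inertia $I_j>0$ about its centre of mass, and centre of mass at (starting point of the link) $+\,r_jp_jz_j$, with $r_j\ge0$ and $|p_j|=1$; the starting points are $0$, $d$, $l_1z_1$ for $j=1,2,3$. Put $J_j=I_j+m_jr_j^2$. Centre of mass. The total centre of mass is $\frac{1}{m_1+m_2+m_3}(F_1z_1+F_2z_2+F_3)$ with $F_1=m_1r_1p_1+m_3l_1+G_1m_3r_3p_3$, $F_2=m_2r_2p_2+G_2m_3r_3p_3$, $F_3=m_2d+G_3m_3r_3p_3$. Angular momentum. With $\langle a,b\rangle=\mathrm{Re}(a\bar b)$, the total angular momentum is $$H=J_1\dot\theta_1+\big(\langle d,m_2r_2p_2z_2\rangle+J_2\big)\dot\theta_2+\langle l_1z_1+r_3p_3z_3,\ m_3(l_1z_1\dot\theta_1+r_3p_3z_3\dot\theta_3)\rangle+I_3\dot\theta_3.$$ Substituting $z_3=G_1z_1+G_2z_2+G_3$, $z_3\dot\theta_3=G_1z_1\dot\theta_1+G_2z_2\dot\theta_2$ and $\dot\theta_3=\langle z_3,z_3\dot\theta_3\rangle$ gives $H=K_3\dot\theta_1+K_4\dot\theta_2$, where $K_3,K_4$ are functions of $(z_1,z_2)$. Put $K=K_1K_4-K_2K_3$. Balancing. The mechanism is dynamically balanced in the mode $z_2\neq -1$ if there is an infinite set $S$ of configurations, all satisfying $z_2\neq -1$, such that $F_1z_1+F_2z_2$ is constant on $S$ (the centre of mass is stationary) and $K(z_1,z_2)=0$ for all $(z_1,z_2)\in S$ (the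 angular momentum vanishes). *)

(* Defs.v *)
From HB Require Import structures.
From mathcomp Require Import all_boot all_order all_algebra.
From mathcomp Require Import boolp classical_sets cardinality reals.
From mathcomp Require Import complex.
From mathcomp Require Import ring.

Set Implicit Arguments.
Unset Strict Implicit.
Unset Printing Implicit Defensive.

Import Order.TTheory GRing.Theory Num.Theory.
Local Open Scope ring_scope.
Local Open Scope complex_scope.

(* The centre of mass of a link in direction z is its starting point plus
   com_dist * com_dir * z; the moment of inertia is taken about it. *)
Record link (R : realType) := Link {
  len : R;
  mass : R;
  inertia : R;
  com_dist : R;
  com_dir : R[i];
  len_gt0 : 0 < len;
  mass_gt0 : 0 < mass;
  inertia_gt0 : 0 < inertia;
  com_dist_ge0 : 0 <= com_dist;
  com_dir_unit : `|com_dir| = 1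
}.

(* Link 1 runs from 0 to l1 z1, link 2 from d to d + l2 z2 and link 3 (the
   coupler) from l1 z1 to l1 z1 + l3 z3 = d + l2 z2, where d is the base. *)
Record fourbar (R : realType) := FourBar {
  base : R;
  link1 : link R;
  link2 : link R;
  link3 : link R;
  base_gt0 : 0 < base
}.

Section Link.
Variables (R : realType) (L : link R).

(* J_j = I_j + m_j r_j^2 *)
Definition Jpar : R := inertia L + mass L * com_dist L ^+ 2.

(* q_j = m_j r_j p_j *)
Definition qpar : R[i] := (mass L)%:C * (com_dist L)%:C * com_dir L.

End Link.

Section FourBar.
Variables (R : realType) (M : fourbar R).

Local Notation d := (base M).
Local Notation l1 := (len (link1 M)).
Local Notation l2 := (len (link2 M)).
Local Notation l3 := (len (link3 M)).
Local Notation m2 := (mass (link2 M)).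
Local Notation m3 := (mass (link3 M)).
Local Notation r2 := (com_dist (link2 M)).
Local Notation r3 := (com_dist (link3 M)).
Local Notation p2 := (com_dir (link2 M)).
Local Notation p3 := (com_dir (link3 M)).

Definition G1 : R[i] := (- l1 / l3)%:C.
Definition G2 : R[i] := (l2 / l3)%:C.
Definition G3 : R[i] := (d / l3)%:C.

Definition closure_defect (z1 z2 : R[i]) : R[i] :=
  (G1 * z1 + G2 * z2 + G3) * (G1 * z1^-1 + G2 * z2^-1 + G3) - 1.

Definition configuration (z : R[i] * R[i]) : Prop :=
  [/\ `|z.1| = 1, `|z.2| = 1 & closure_defect z.1 z.2 = 0].

Definition K1 (z1 z2 : R[i]) : R[i] :=
  G1 * G2 * (z1 * z2^-1 - z1^-1 * z2) + G1 * G3 * (z1 - z1^-1).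

Definition K2 (z1 z2 : R[i]) : R[i] :=
  G1 * G2 * (z1^-1 * z2 - z1 * z2^-1) + G2 * G3 * (z2 - z2^-1).

(* The centre of mass is (F1 z1 + F2 z2 + F3) / (m1 + m2 + m3); the constant
   F3 plays no role in its being stationary. *)
Definition F1 : R[i] :=
  qpar (link1 M) + m3%:C * l1%:C + G1 * m3%:C * r3%:C * p3.
Definition F2 : R[i] := qpar (link2 M) + G2 * m3%:C * r3%:C * p3.

(* The inner product <a, b> = Re (a conj(b)) of the plane. *)
Definition dotC (a b : R[i]) : R := complex.Re (a * b^*).

(* The angular momentum H, where w1 and w2 are the angular velocities of links
   1 and 2, after the substitutions z3 = G1 z1 + G2 z2 + G3,
   z3 w3 = G1 z1 w1 + G2 z2 w2 (called v3) and w3 = <z3, z3 w3>. *)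
Definition angular_momentum (z1 z2 : R[i]) (w1 w2 : R) : R :=
  let z3 := G1 * z1 + G2 * z2 + G3 in
  let v3 := G1 * z1 * w1%:C + G2 * z2 * w2%:C in
  let w3 := dotC z3 v3 in
  Jpar (link1 M) * w1
  + (dotC d%:C (m2%:C * r2%:C * p2 * z2) + Jpar (link2 M)) * w2
  + dotC (l1%:C * z1 + r3%:C * p3 * z3)
         (m3%:C * (l1%:C * z1 * w1%:C + r3%:C * p3 * v3))
  + inertia (link3 M) * w3.

(* H is linear in (w1, w2); K3 and K4 are its coefficients, see
   angular_momentumE. *)
Definition K3 (z1 z2 : R[i]) : R := angular_momentum z1 z2 1 0.
Definition K4 (z1 z2 : R[i]) : R := angular_momentum z1 z2 0 1.

Lemma angular_momentumE (z1 z2 : R[i]) (w1 w2 : R) :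
  angular_momentum z1 z2 w1 w2 = K3 z1 z2 * w1 + K4 z1 z2 * w2.
Proof.
rewrite /K3 /K4 /angular_momentum /dotC /G1 /G2 /G3.
case: z1 z2 p2 p3 => [a1 b1] [a2 b2] [a3 b3] [a4 b4] /=.
ring.
Qed.

Definition K (z1 z2 : R[i]) : R[i] :=
  K1 z1 z2 * (K4 z1 z2)%:C - K2 z1 z2 * (K3 z1 z2)%:C.

(* Dynamic balance in the mode z2 <> -1. *)
Definition dynamically_balanced : Prop :=
  exists S : set (R[i] * R[i]),
    [/\ infinite_set S,
        forall z, S z -> configuration z /\ z.2 <> -1,
        exists c : R[i], forall z, S z -> F1 * z.1 + F2 * z.2 = c
      & forall z, S z -> K z.1 z.2 = 0].

End FourBar.

(* Main.v *)
Require Import Defs.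
From mathcomp Require Import all_boot all_order all_algebra.
From mathcomp Require Import reals complex.
From mathcomp Require Import classical_sets cardinality ring.

Import Order.TTheory GRing.Theory Num.Theory.
Local Open Scope ring_scope.
Local Open Scope complex_scope.

(* Put g = d / l. On the branch z2 <> -1 the closure equation reads
   z2 = x (x - g) / (g x - 1) with x = z1 (equivalently z2 = z1 z3), so every
   balance condition is a rational identity in x that holds at infinitely many
   points. The centre of mass gives F1 = - g F2 and F2 = - g F1, hence
   F1 = F2 = 0. Then K is a nonzero factor times a polynomial of degree 4 whose
   coefficients are linear combinations of W = l g (q3 - conj q3) / 2,
   B = J2 + J3 - l (1 - g^2) Re q3 and A = J1 + l^2 m3 - J3; they all vanish iff
   W = B = A = 0. *)

(** * Algebra over a field: polynomials with infinitely many zeros, rational identities on the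
    branch *)

Lemma finite_roots (F : closedFieldType) (p : {poly F}) :
  p != 0 -> finite_set [set x | root p x].
Proof.
move=> p0; have [rs prs] := closed_field_poly_normal p.
apply: (@sub_finite_set _ _ [set` rs]); last exact: finite_seq.
by move=> x /=; rewrite prs rootZ ?lead_coef_eq0// root_prod_XsubC.
Qed.

(** A point of a graph is determined by its first coordinate, so an infinite set of such points has
    infinitely many first coordinates, too many roots for a nonzero polynomial. *)
Lemma coefs_eq0_of_infinite_graph (F : closedFieldType) (S : set (F * F))
    (f : F -> F) (s : seq F) :
  infinite_set S -> (forall z, S z -> z.2 = f z.1) ->
  (forall z, S z -> (Poly s).[z.1] = 0) -> forall i, s`_i = 0.
Proof.
move=> Sinf Sf Sroot i; rewrite -coef_Poly.
have [->|p0] := eqVneq (Poly s) 0; first by rewrite coef0.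
case: Sinf; apply: sub_finite_set (finite_image (fun x => (x, f x)) (finite_roots _ _ p0)).
by move=> [x y] Sxy; exists x; [apply/rootP/(Sroot _ Sxy)|rewrite -(Sf _ Sxy)].
Qed.

(* q', z3' stand for the conjugates of q, z3, the conjugate of a unit complex
   number being its inverse; see K_mode. *)
Lemma mode_identity (F : fieldType) (l g q q' a J2 J3 x : F)
    (z2 := x * (x - g) / (g * x - 1)) (z3 := - x + g * z2 + g) (z3' := - x^-1 + g * z2^-1 + g) :
  (2 : F) != 0 -> x != 0 -> g * x - 1 != 0 -> x - g != 0 ->
  (- g * (x / z2 - x^-1 * z2) - g * (x - x^-1)) *
  ((- (l * g ^+ 2) * (q * z2 + q' * z2^-1) / 2 + J2)
   + l * g * (x * (q' * z2^-1) + x^-1 * (q * z2)) / 2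
   + J3 * g * (z3 * z2^-1 + z3' * z2) / 2)
  - (- g * (x^-1 * z2 - x / z2) + g ^+ 2 * (z2 - z2^-1)) *
    (a - l * (q + q') / 2 + l * (q * z3 * x^-1 + q' * z3' * x) / 2
     - J3 * (z3 * x^-1 + z3' * x) / 2)
  = g * (x ^+ 2 - 1) / (x ^+ 2 * (g * x - 1) * (x - g)) *
    ((2 * x - g - g * x ^+ 2) *
     ((J2 - l * (1 - g ^+ 2) * (q + q') / 2 + J3) * x
      - l * g * (q - q') / 2 * (x ^+ 2 - 1))
     - (a - J3) * (g * x - 1) * (x - g) * x).
Proof.
move=> h2 hx h1 hg; rewrite /z3 /z3' /z2.
field.
by rewrite h2 hx h1 hg.
Qed.

(** The closure curve is reducible: its equation has the factor [y + 1], which is the excluded mode,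
    and a second factor of degree one in [y], which is the branch. *)
Lemma mode_branch (F : fieldType) (g x y : F) :
  x != 0 -> y != 0 -> g != 0 -> y != -1 ->
  ((- x + g * y + g) * (- x^-1 + g * y^-1 + g) - 1 = 0) <->
  (y * (g * x - 1) = x * (x - g)).
Proof.
move=> x0 y0 g0 y1.
have -> : (- x + g * y + g) * (- x^-1 + g * y^-1 + g) - 1 =
          g * (y + 1) / (x * y) * (y * (g * x - 1) - x * (x - g)).
  by field; rewrite x0 y0.
split=> [/eqP|->]; last by rewrite subrr mulr0.
rewrite mulf_eq0 subr_eq0 => /orP[|/eqP//].
rewrite !(mulf_eq0, invr_eq0) addr_eq0.
by rewrite (negPf x0) (negPf y0) (negPf g0) (negPf y1).
Qed.

(** * Conjugation on the unit circle and the angular momentum *)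

(** Used to trade real parts for conjugates, which are inverses on the unit circle; the momentum
    thereby becomes rational in [z1] and [z2]. *)
Lemma dotCE (R : realType) (a b : R[i]) :
  (dotC a b)%:C = (a * (b^*)%R + (a^*)%R * b) / 2.
Proof.
(* The generic conjugation and the one specific to [R[i]] are convertible; the second computes on
   coordinates. *)
rewrite -[(a^*)%R]/(a^*) -[(b^*)%R]/(b^*).
apply: (mulIf (_ : (2 : R[i]) != 0)); first by rewrite pnatr_eq0.
rewrite divfK ?pnatr_eq0//.
case: a b => [a b] [c e]; rewrite /dotC; simpc.
by apply/eqP; rewrite eq_complex /=; apply/andP; split; apply/eqP; ring.
Qed.

Lemma unit_conjc (R : rcfType) (z : R[i]) : `|z| = 1 -> (z^*)%R = z^-1.
Proof.
move=> z1; have z0 : z != 0 by rewrite -normr_gt0 z1.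
by apply: (mulfI z0); rewrite divff// -normCK z1 expr1n.
Qed.

Lemma G1_eqN1 (R : realType) (M : fourbar R) :
  len (link3 M) = len (link1 M) -> G1 M = -1.
Proof.
by move=> h; rewrite /G1 h mulNr divff ?gt_eqF ?len_gt0// raddfN.
Qed.

(** Because [|p3| = 1], the term [m3 r3^2 <p3 z3, p3 v3>] is [m3 r3^2 <z3, v3>] and merges with the
    inertia of the coupler into [J3]. *)
Lemma angular_momentum_qpar (R : realType) (M : fourbar R) (z1 z2 : R[i]) (w1 w2 : R)
    (q3 := qpar (link3 M)) (z3 := G1 M * z1 + G2 M * z2 + G3 M)
    (v3 := G1 M * z1 * w1%:C + G2 M * z2 * w2%:C) :
  angular_momentum M z1 z2 w1 w2 =
  Jpar (link1 M) * w1 + (dotC (base M)%:C (qpar (link2 M) * z2) + Jpar (link2 M)) * w2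
  + mass (link3 M) * len (link1 M) ^+ 2 * w1 * dotC z1 z1
  + len (link1 M) * (dotC z1 (q3 * v3) + w1 * dotC (q3 * z3) z1)
  + Jpar (link3 M) * dotC z3 v3.
Proof.
rewrite /angular_momentum -/z3 -/v3 /q3 /qpar /Jpar /dotC.
have := com_dir_unit (link3 M).
case: (com_dir (link3 M)) => pa pb; case: z3 v3 => [a b] [c e].
case: z1 => x y; case: (com_dir (link2 M)) => p2a p2b; case: z2 => u v.
move/(congr1 (fun z : R[i] => z ^+ 2)).
rewrite sqr_normc expr1n => /(congr1 (@complex.Re R)) /= unit_p.
have {unit_p} pp : pa ^+ 2 = 1 - pb ^+ 2 by rewrite -unit_p; ring.
ring: pp.
Qed.

(** At [x = 1] and [x = -1] the branch meets the other mode, since there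
    [x * (x - g) = - (g * x - 1)]. This allows the factor [x ^+ 2 - 1] of [K] to be cancelled. *)
Lemma sqr_neq1_of_mode (F : fieldType) (g x y : F) :
  g * x - 1 != 0 -> y * (g * x - 1) = x * (x - g) -> y != -1 -> x ^+ 2 - 1 != 0.
Proof.
move=> gx e; apply: contra => /eqP x1.
have /eqP : (y + 1) * (g * x - 1) = 0.
  by rewrite mulrDl e -x1; ring.
by rewrite mulf_eq0 (negPf gx) orbF addr_eq0.
Qed.

(** Either equality would force the modulus [c] to be 1. With [c = d / l] this is where [l <> d]
    keeps the denominators of the branch nonzero. *)
Lemma unit_scale_neq1 (R : rcfType) (c : R) (x : R[i]) :
  0 < c -> c != 1 -> `|x| = 1 -> c%:C * x - 1 != 0 /\ x - c%:C != 0.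
Proof.
move=> c0 c1 x1.
have nc : `|c%:C| = c%:C by rewrite ger0_norm// lecR ltW.
have cC1 : c%:C != 1 by rewrite eq_complex /= eqxx andbT.
split; rewrite subr_eq0; apply: contra cC1 => /eqP /(congr1 Num.norm).
  by rewrite normrM nc x1 mulr1 normr1 => ->.
by rewrite nc x1 => <-.
Qed.

(** Replacing conjugates of [x] and [y] by inverses turns [K3] and [K4] into rational functions, and
    [mode_identity] then factors [K]. The value of [qpar (link2 M)] is the one forced by the centre
    of mass. *)
Lemma K_mode (R : realType) (M : fourbar R) (x y : R[i])
    (l := len (link1 M)) (d := len (link2 M)) (g := (d / l)%:C)
    (q := qpar (link3 M)) (J2 := (Jpar (link2 M))%:C) (J3 := (Jpar (link3 M))%:C)
    (a := (Jpar (link1 M) + l ^+ 2 * mass (link3 M))%:C) :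
  len (link3 M) = l -> base M = d -> `|x| = 1 -> `|y| = 1 ->
  g * x - 1 != 0 -> x - g != 0 ->
  y * (g * x - 1) = x * (x - g) -> qpar (link2 M) = - g * q ->
  K M x y = g * (x ^+ 2 - 1) / (x ^+ 2 * (g * x - 1) * (x - g)) *
    ((2 * x - g - g * x ^+ 2) *
     ((J2 - l%:C * (1 - g ^+ 2) * (q + (q^*)%R) / 2 + J3) * x
      - l%:C * g * (q - (q^*)%R) / 2 * (x ^+ 2 - 1))
     - (a - J3) * (g * x - 1) * (x - g) * x).
Proof.
move=> hl3 hd x1 y1 gx xg hy hq2.
have l0 : l%:C != 0 :> R[i] by rewrite eq_complex /= eqxx andbT gt_eqF ?len_gt0.
have dE : d%:C = l%:C * g by rewrite /g rmorphM/= fmorphV/= mulrC divfK.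
have G1E : G1 M = -1 by exact: G1_eqN1.
have G2E : G2 M = g by rewrite /G2 hl3.
have G3E : G3 M = g by rewrite /G3 hl3 hd.
have rc (c : R) : (c%:C^*)%R = c%:C by exact: conjc_real.
have x0 : x != 0 by rewrite -normr_gt0 x1.
have y0 : y != 0 by rewrite -normr_gt0 y1.
have n2 : (2 : R[i]) != 0 by rewrite pnatr_eq0.
have yE : y = x * (x - g) / (g * x - 1) by rewrite -hy mulfK.
rewrite -(mode_identity _ l%:C g q (q^*)%R a J2 J3 x)// -yE.
rewrite /K /K1 /K2 G1E G2E G3E.
have gc : (g^*)%R = g by exact: rc.
have -> : (K4 M x y)%:C = - (l%:C * g ^+ 2) * (q * y + (q^*)%R * y^-1) / 2 + J2
   + l%:C * g * (x * ((q^*)%R * y^-1) + x^-1 * (q * y)) / 2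
   + J3 * g * ((- x + g * y + g) * y^-1 + (- x^-1 + g * y^-1 + g) * y) / 2.
  rewrite /K4 angular_momentum_qpar G1E G2E G3E hd hq2 -[len (link1 M)]/l.
  rewrite /q /J2 /J3; clear q J2 J3 a hq2.
  clearbody g; move: (Jpar _) (Jpar _) (Jpar _) (qpar _) => J1 J2 J3 q.
  rewrite !mulr0 !mul0r !mulr1 !add0r addr0.
  rewrite !(rmorphD, rmorphM)/= !dotCE.
  rewrite !(rmorphD, rmorphM, rmorphN)/= gc (unit_conjc _ _ x1) (unit_conjc _ _ y1) rc dE rmorph1 rmorph0.
  by field; rewrite y0 x0.
have -> : (K3 M x y)%:C = a - l%:C * (q + (q^*)%R) / 2
   + l%:C * (q * (- x + g * y + g) * x^-1 + (q^*)%R * (- x^-1 + g * y^-1 + g) * x) / 2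
   - J3 * ((- x + g * y + g) * x^-1 + (- x^-1 + g * y^-1 + g) * x) / 2.
  rewrite /K3 angular_momentum_qpar G1E G2E G3E hd hq2 -[len (link1 M)]/l.
  rewrite /q /J3 /a; clear q J2 J3 a hq2.
  clearbody g; move: (Jpar _) (Jpar _) (Jpar _) (qpar _) => J1 J2 J3 q.
  rewrite !mulr0 !mulr1 !addr0.
  rewrite !(rmorphD, rmorphM)/= !dotCE.
  rewrite !(rmorphD, rmorphM, rmorphN)/= gc (unit_conjc _ _ x1) (unit_conjc _ _ y1) rmorph1.
  by field; rewrite y0 x0.
ring.
Qed.

(** * Configurations of the mode and their infinitude *)

(** Here [G1 = -1] and [G2 = G3 = g], so the closure equation has the shape treated in
    [mode_branch]. *)
Lemma mode_of_configuration (R : realType) (M : fourbar R) (z : R[i] * R[i])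
    (l := len (link1 M)) (d := len (link2 M)) (g := (d / l)%:C) :
  len (link3 M) = l -> base M = d -> l <> d -> configuration M z -> z.2 <> -1 ->
  [/\ g * z.1 - 1 != 0, z.1 - g != 0 & z.2 * (g * z.1 - 1) = z.1 * (z.1 - g)].
Proof.
move=> hl3 hd hld [z1 z2 + z2N]; rewrite /closure_defect (G1_eqN1 _ _ hl3) /G2 /G3 hl3 hd.
have l0 : 0 < l by exact: len_gt0.
have g0 : 0 < d / l by rewrite divr_gt0// len_gt0.
rewrite -/d -/l !mulN1r => /mode_branch h.
have [] := unit_scale_neq1 _ _ z.1 g0 _ z1.
  by apply: contra_not_neq hld => /divr1_eq ->.
split=> //; apply: h; rewrite -?normr_gt0 ?z1 ?z2// ?normr_gt0.
- by rewrite eq_complex /= eqxx andbT gt_eqF.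
- exact/eqP.
Qed.

Lemma configuration_of_link1 (R : realType) (M : fourbar R) (x : R[i])
    (l := len (link1 M)) (d := len (link2 M)) :
  len (link3 M) = l -> base M = d -> l <> d -> `|x| = 1 -> x ^+ 2 != 1 ->
  exists2 y, configuration M (x, y) & y <> -1.
Proof.
move=> hl3 hd hld x1 xx.
have l0 : 0 < l by exact: len_gt0.
have dl0 : 0 < d / l by rewrite divr_gt0// len_gt0.
pose g : R[i] := (d / l)%:C.
have gc : (g^*)%R = g by exact: conjc_real.
have g0 : g != 0 by rewrite eq_complex /= eqxx andbT gt_eqF.
have x0 : x != 0 by rewrite -normr_gt0 x1.
have [] := unit_scale_neq1 _ _ x dl0 _ x1; rewrite -/g.
  by apply: contra_not_neq hld => /divr1_eq ->.
move=> gx xg; pose y := x * (x - g) / (g * x - 1).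
have yE : y * (g * x - 1) = x * (x - g) by rewrite divfK.
have y1 : `|y| = 1.
  (* For [x] on the unit circle and [g] real, the conjugate of [x - g] is [- (g * x - 1) / x]. *)
  have e : `|x - g| = `|g * x - 1|.
    rewrite -norm_conjC rmorphB/= gc (unit_conjc _ _ x1).
    have -> : x^-1 - g = - (g * x - 1) / x by move: (g) => h; field.
    by rewrite normrM normrN normfV x1 invr1 mulr1.
  by rewrite /y !normrM normfV x1 mul1r e divff// normr_eq0.
(* With [y = -1] the branch equation reads [1 - g * x = x ^+ 2 - g * x]. *)
have yN : y != -1.
  apply: contra xx => /eqP yN; rewrite -subr_eq0; apply/eqP.
  by move/eqP: yE; rewrite yN -subr_eq0 => /eqP h; rewrite -[RHS]oppr0 -h; ring.
exists y; last exact/eqP.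
split=> //; rewrite /closure_defect (G1_eqN1 _ _ hl3) /G2 /G3 hl3 hd.
rewrite -/d -/l !mulN1r.
by apply/mode_branch => //; rewrite -normr_gt0 y1.
Qed.

Lemma infinite_unit_circle_sqr_neq1 (R : realType) :
  infinite_set [set x : R[i] | `|x| = 1 /\ x ^+ 2 != 1].
Proof.
(* Distinct real parts strictly between 0 and 1; starting at 1/2 keeps the imaginary part positive
   and so avoids 1 and -1. *)
pose c n : R := n.+2%:R^-1.
have c0 n : 0 < c n by rewrite invr_gt0 ltr0n.
have c1 n : c n < 1 by rewrite invf_lt1 ?ltr1n ?ltr0n.
have s0 n : 0 < 1 - c n ^+ 2 by rewrite subr_gt0 expr_lt1// ltW.
pose f n : R[i] := c n +i* Num.sqrt (1 - c n ^+ 2).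
move=> fin; apply: infinite_nat.
suff -> : setT = (f @^-1` [set x : R[i] | `|x| = 1 /\ x ^+ 2 != 1])%classic.
  apply: finite_preimage fin => m n _ _ [] /invr_inj /eqP.
  by rewrite eqr_nat => /eqP [].
apply/seteqP; split=> // n _; split.
  by rewrite normc_def /= sqr_sqrtr ?ltW// addrC subrK sqrtr1.
rewrite sqrf_eq1 !eq_complex /= !oppr0.
by rewrite ![Num.sqrt _ == 0]gt_eqF ?sqrtr_gt0// !andbF.
Qed.

(** * Comparison of coefficients, and the converse *)

Theorem mainTheorem3 (R : realType) (M : fourbar R) (l d : R)
    (q1 := qpar (link1 M)) (q2 := qpar (link2 M)) (q3 := qpar (link3 M))
    (J1 := Jpar (link1 M)) (J2 := Jpar (link2 M)) (J3 := Jpar (link3 M))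
    (m3 := mass (link3 M))
    (hl1 : len (link1 M) = l) (hl3 : len (link3 M) = l)
    (hl2 : len (link2 M) = d) (hd : base M = d) (hld : l <> d) :
  dynamically_balanced M <->
  [/\ q1 = q3 - l%:C * m3%:C,
      q2 = - (d / l)%:C * q3,
      J1 = J3 - l ^+ 2 * m3
    & J2%:C = ((l ^+ 2 - d ^+ 2) / l)%:C * q3 - J3%:C].
Proof.
have l0 : 0 < l by rewrite -hl1 len_gt0.
have d0 : 0 < d by rewrite -hl2 len_gt0.
pose g : R[i] := (d / l)%:C.
have n2 : (2 : R[i]) != 0 by rewrite pnatr_eq0.
have lC0 : l%:C != 0 :> R[i] by rewrite eq_complex /= eqxx andbT gt_eqF.
have g0 : g != 0 by rewrite eq_complex /= eqxx andbT gt_eqF ?divr_gt0.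
have g1 : 1 - g ^+ 2 != 0.
  rewrite subr_eq0 eq_sym sqrf_eq1 !eq_complex /= !oppr0 !eqxx !andbT negb_or.
  apply/andP; split; last by rewrite gt_eqF// (lt_trans (ltrN10 _)) ?divr_gt0.
  by apply: contra_not_neq hld => /divr1_eq ->.
have F1E : F1 M = q1 + l%:C * m3%:C - q3.
  rewrite /F1 G1_eqN1 ?hl1// /q1 /q3 /qpar.
  by rewrite -/m3; ring.
have F2E : F2 M = q2 + g * q3.
  by rewrite /F2 /G2 hl2 hl3 -/q2 /q3 /qpar -!mulrA.
have branch z : configuration M z -> z.2 <> -1 ->
    [/\ g * z.1 - 1 != 0, z.1 - g != 0 & z.2 * (g * z.1 - 1) = z.1 * (z.1 - g)].
  by have := mode_of_configuration _ M z; rewrite hl1 hl2; apply.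
have kE : ((l ^+ 2 - d ^+ 2) / l)%:C = l%:C * (1 - g ^+ 2).
  have -> : (l ^+ 2 - d ^+ 2) / l = l * (1 - (d / l) ^+ 2) by field; rewrite gt_eqF.
  by rewrite rmorphM rmorphB rmorph1 rmorphXn.
pose W := l%:C * g * (q3 - (q3^*)%R) / 2.
pose B := J2%:C - l%:C * (1 - g ^+ 2) * (q3 + (q3^*)%R) / 2 + J3%:C.
pose A := (J1 + l ^+ 2 * m3)%:C - J3%:C.
have KE z : q2 = - g * q3 -> configuration M z -> z.2 <> -1 ->
  K M z.1 z.2 = g * (z.1 ^+ 2 - 1) / (z.1 ^+ 2 * (g * z.1 - 1) * (z.1 - g)) *
    ((2 * z.1 - g - g * z.1 ^+ 2) * (B * z.1 - W * (z.1 ^+ 2 - 1))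
     - A * (g * z.1 - 1) * (z.1 - g) * z.1).
  move=> hq2 cz zN; have [gx xg yE] := branch z cz zN; have [z1 z2 _] := cz.
  by have := K_mode _ M z.1 z.2; rewrite hl1 hl2; apply.
split.
- case=> S [Sinf Smode [c Sc] SK].
  pose f x := x * (x - g) / (g * x - 1).
  have Sgraph z : S z -> z.2 = f z.1.
    by case/Smode=> cz zN; have [gx _ e] := branch z cz zN; rewrite /f -e mulfK.
  (* Multiplying [F1 x + F2 y = c] by [g x - 1] and substituting the branch equation leaves a
     quadratic in [x]. *)
  have comroot z : S z ->
      (Poly [:: c; - F1 M - F2 M * g - c * g; F1 M * g + F2 M]).[z.1] = 0.
    move=> Sz; have [cz zN] := Smode z Sz; have [gx xg yE] := branch z cz zN.
    rewrite horner_Poly /= mul0r add0r.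
    transitivity ((F1 M * z.1 + F2 M * z.2 - c) * (g * z.1 - 1)).
      rewrite [RHS](_ : _ = (F1 M * z.1 - c) * (g * z.1 - 1) + F2 M * (z.2 * (g * z.1 - 1))).
        by rewrite yE; ring.
      by ring.
    by rewrite (Sc z Sz) subrr mul0r.
  have comcoef := coefs_eq0_of_infinite_graph _ _ f _ Sinf Sgraph comroot.
  (* The constant coefficient is [c] itself; once it is zero, the other two give [F1 = - g F2] and
     [F2 = - g F1], and [g ^+ 2] differs from 1. *)
  have /= c0 := comcoef 0; have /= := comcoef 1; rewrite c0 => com1.
  have /= com2 := comcoef 2.
  have F20 : F2 M = - (F1 M * g) by apply/eqP; rewrite -addr_eq0 addrC com2.
  have F10 : F1 M = 0.
    apply: (mulIf g1); rewrite mul0r -[RHS]oppr0 -com1 F20; ring.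
  have hq2 : q2 = - g * q3.
    by apply/eqP; rewrite mulNr -addr_eq0 -F2E F20 F10 mul0r oppr0.
  (* These are the coefficients of the quartic factor in [KE]; the prefactor is nonzero on the
     mode. *)
  have Kroot z : S z -> (Poly [:: - (g * W); 2 * W - g * B - A * g;
      2 * B + A * (1 + g ^+ 2); - 2 * W - g * B - A * g; g * W]).[z.1] = 0.
    move=> Sz; have [cz zN] := Smode z Sz; have [gx xg yE] := branch z cz zN.
    have x0 : z.1 != 0 by case: cz => z1 _ _; rewrite -normr_gt0 z1.
    have x1 := sqr_neq1_of_mode _ _ _ _ gx yE (introN eqP zN).
    rewrite horner_Poly /=; have := SK z Sz; rewrite KE// => /eqP.
    rewrite !(mulf_eq0, invr_eq0, negb_or, expf_eq0) /=.
    rewrite (negPf g0) (negPf x0) (negPf x1) (negPf gx) (negPf xg) /= => /eqP h.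
    by rewrite -[RHS]h; ring.
  have Kcoef := coefs_eq0_of_infinite_graph _ _ f _ Sinf Sgraph Kroot.
  have W0 : W = 0 by apply: (mulfI g0); rewrite mulr0; exact: (Kcoef 4).
  (* Once [W = 0], the linear coefficient gives [B = - A], and the quadratic one becomes
     [- A * (1 - g ^+ 2)]. *)
  have := Kcoef 1; have := Kcoef 2; rewrite /= W0 mulr0 add0r => k2 k1.
  have BA : B = - A.
    by apply: (mulfI g0); apply/eqP; rewrite -subr_eq0 -oppr_eq0 -k1; apply/eqP; ring.
  have A0 : A = 0.
    apply: (mulIf g1); rewrite mul0r -[RHS]oppr0 -k2 BA; ring.
  have q3R : (q3^*)%R = q3.
    move/eqP: W0; rewrite /W !mulf_eq0 (negPf lC0) (negPf g0) invr_eq0 (negPf n2).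
    by rewrite orbF subr_eq0 => /eqP.
  split.
  + by apply/eqP; rewrite -subr_eq0 opprB addrA -F1E F10.
  + by rewrite hq2.
  + move: A0; rewrite /A -raddfB => /(congr1 (@complex.Re R)) /=.
    by move/eqP; rewrite subr_eq0 => /eqP <-; rewrite addrK.
  + move: BA; rewrite A0 oppr0 /B q3R kE => /eqP; rewrite -addrA addr_eq0.
    by move=> /eqP ->; move: (g) => h; field.
- case=> hq1 hq2 hJ1 hJ2.
  have k0 : l%:C * (1 - g ^+ 2) != 0 by rewrite mulf_neq0.
  (* The last condition makes a nonzero real multiple of [q3] equal to the real number [J2 + J3], so
     [q3] is real. *)
  have q3R : (q3^*)%R = q3.
    apply: (mulfI k0); rewrite -kE; move/eqP: hJ2; rewrite eq_sym subr_eq => /eqP hJ2.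
    by rewrite hJ2 -[X in X * _](conjc_real ((l ^+ 2 - d ^+ 2) / l)) -rmorphM hJ2 -rmorphD; apply: conjc_real.
  have W0 : W = 0 by rewrite /W q3R subrr mulr0 mul0r.
  have B0 : B = 0 by rewrite /B hJ2 kE q3R; field.
  have A0 : A = 0 by rewrite /A hJ1 subrK subrr.
  have hq2' : q2 = - g * q3 by rewrite hq2.
  (* The whole mode serves as [S]: its first coordinates cover the unit circle except 1 and -1. *)
  exists [set z | configuration M z /\ z.2 <> -1]%classic; split=> //.
  + move=> fin; apply: (@infinite_unit_circle_sqr_neq1 R).
    apply: sub_finite_set (finite_image fst fin) => x [x1 xx].
    have := configuration_of_link1 _ M x; rewrite hl1 hl2 => /(_ hl3 hd hld x1 xx) [y cy yN].
    by exists (x, y).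
  + exists 0 => z _; rewrite F1E F2E hq1 hq2' mulNr addNr mul0r addr0.
    by rewrite subrK subrr mul0r.
  + move=> z [cz zN]; rewrite KE// A0 B0 W0; ring.
Qed.
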